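(* Let $\mathbb{F}$ be a field and let $p_1$ and $p_2$ be split polynomials of degree $2$ with coefficients in $\mathbb{F}$. Then every elementary endomorphism of an $\mathbb{F}$-vector space is a $(p_1,p_2)$-sum.
   Context: $\mathbb{F}$ is an arbitrary field and $t$ is an indeterminate. A polynomial is split if it is a product of polynomials of degree at most one over $\mathbb{F}$ (all its roots lie in $\mathbb{F}$). An endomorphism $u$ (an $\mathbb{F}$-linear map $V\to V$) of an $\mathbb{F}$-vector space $V$ endows $V$ with a structure of $\mathbb{F}[t]$-module such that $t\cdot x=u(x)$ for all $x\in V$; this module is denoted $V^u$. The endomorphism $u$ is called elementary when the module $V^u$ is free, i.e. isomorphic to a direct sum of (potentially infinitely many) copies of $\mathbb{F}[t]$. For polynomials $p_1,\dots,p_n\in\mathbb{F}[t]$, an endomorphism $u$ of a vector space $V$ is called a $(p_1,\dots,p_n)$-sum when there exist endomorphisms $u_1,\dots,u_n$ of $V$ such that $u=\sum_{k=1}^n u_k$ and $p_k(u_k)=0$ for all $k\in\{1,\dots,n\}$. *)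

(* Defs.v *)
From HB Require Import structures.
From mathcomp Require Import all_boot all_order all_algebra.
From mathcomp.multinomials Require Import freeg.

Set Implicit Arguments.
Unset Strict Implicit.
Unset Printing Implicit Defensive.

Import GRing.Theory.
Local Open Scope ring_scope.

(* The zero polynomial and constants are allowed as factors. *)
Definition split_poly (F : fieldType) (p : {poly F}) : Prop :=
  exists2 s : seq {poly F},
    all (fun q : {poly F} => (size q <= 2)%N) s & p = \prod_(q <- s) q.

(* p(u), as a map V -> V: the type {linear V -> V} carries no ring structure
   when V may be infinite dimensional, so horner_alg is not available. *)
Definition poly_endo (F : fieldType) (V : lmodType F) (u : {linear V -> V})
    (p : {poly F}) (x : V) : V :=
  \sum_(i < size p) p`_i *: iter i u x.

Section PolyEndo.
Variables (F : fieldType) (V : lmodType F) (u : {linear V -> V}).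
Implicit Types (p q : {poly F}) (x y : V) (c : F).

Lemma poly_endo_widen n p x : (size p <= n)%N ->
  poly_endo u p x = \sum_(i < n) p`_i *: iter i u x.
Proof.
move=> le_pn; rewrite /poly_endo.
rewrite (big_ord_widen n (fun i => p`_i *: iter i u x) le_pn) big_mkcond /=.
apply: eq_bigr => i _; case: ltnP => // le_pi.
by rewrite nth_default // scale0r.
Qed.

Lemma poly_endoDl p q x :
  poly_endo u (p + q) x = poly_endo u p x + poly_endo u q x.
Proof.
pose n := maxn (size p) (size q).
rewrite (@poly_endo_widen n (p + q)) ?size_polyD //.
rewrite (@poly_endo_widen n p) ?leq_maxl // (@poly_endo_widen n q) ?leq_maxr //.
by rewrite -big_split; apply: eq_bigr => i _; rewrite coefD scalerDl.
Qed.

Lemma iter_linear n c x y :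
  iter n u (c *: x + y) = c *: iter n u x + iter n u y.
Proof. by elim: n => //= n ->; rewrite linearP. Qed.

Lemma poly_endo_linear p c x y :
  poly_endo u p (c *: x + y) = c *: poly_endo u p x + poly_endo u p y.
Proof.
rewrite /poly_endo scaler_sumr -big_split; apply: eq_bigr => i _.
by rewrite iter_linear scalerDr !scalerA mulrC.
Qed.

Lemma poly_endoDr p x y :
  poly_endo u p (x + y) = poly_endo u p x + poly_endo u p y.
Proof. by rewrite -{1}[x]scale1r poly_endo_linear scale1r. Qed.

Lemma poly_endoC c x : poly_endo u c%:P x = c *: x.
Proof.
rewrite (@poly_endo_widen 1) ?size_polyC ?leq_b1 //.
by rewrite big_ord1 coefC.
Qed.

Lemma poly_endo1 x : poly_endo u 1 x = x.
Proof. by rewrite poly_endoC scale1r. Qed.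

Lemma poly_endoZ c p x : poly_endo u (c *: p) x = c *: poly_endo u p x.
Proof.
rewrite (@poly_endo_widen (size p)) ?size_scale_leq // scaler_sumr.
by apply: eq_bigr => i _; rewrite coefZ scalerA.
Qed.

Lemma poly_endoMX p x : poly_endo u (p * 'X) x = u (poly_endo u p x).
Proof.
have le_s : (size (p * 'X)%R <= (size p).+1)%N.
  by rewrite (leq_trans (size_polyMleq p _)) ?size_polyX ?addn2.
rewrite (poly_endo_widen _ le_s) big_ord_recl coefMX /= scale0r add0r linear_sum.
by apply: eq_bigr => i _; rewrite coefMX /= linearZ.
Qed.

Lemma poly_endoM p q x :
  poly_endo u (p * q) x = poly_endo u p (poly_endo u q x).
Proof.
elim/poly_ind: p => [|p c IHp].
  by rewrite mul0r /poly_endo size_poly0 !big_ord0.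
rewrite mulrDl !poly_endoDl mul_polyC poly_endoZ poly_endoC -mulrA.
by rewrite -(commr_polyX q) mulrA !poly_endoMX IHp.
Qed.

End PolyEndo.

(* The F[t]-module V^u: a copy of V on which p acts as p(u). *)
Definition endo_module (F : fieldType) (V : lmodType F) (u : {linear V -> V}) :
  Type := V.

Section EndoModule.
Variables (F : fieldType) (V : lmodType F) (u : {linear V -> V}).

HB.instance Definition _ := GRing.Zmodule.copy (endo_module u) V.

HB.instance Definition _ :=
  GRing.Zmodule_isLmodule.Build {poly F} (endo_module u)
    (fun p q x => esym (poly_endoM u p q x)) (poly_endo1 u)
    (fun p x y => poly_endoDr u p x y) (fun x p q => poly_endoDl u p q x).

Lemma endo_module_scaleE (p : {poly F}) (x : endo_module u) :
  p *: x = poly_endo u p x.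
Proof. by []. Qed.

Lemma endo_module_scaleX (x : endo_module u) : 'X *: x = u x.
Proof.
by rewrite endo_module_scaleE -[in LHS](mul1r 'X) poly_endoMX poly_endo1.
Qed.

End EndoModule.

(* {freeg I / {poly F}} is the direct sum of copies of F[t] indexed by the
   possibly infinite type I. *)
Definition elementary (F : fieldType) (V : lmodType F) (u : {linear V -> V}) :
  Prop :=
  exists (I : choiceType)
         (f : {linear {freeg I / {poly F}} -> endo_module u}), bijective f.

Definition poly_sum (F : fieldType) (n : nat) (p : n.-tuple {poly F})
    (V : lmodType F) (u : {linear V -> V}) : Prop :=
  exists v : 'I_n -> {linear V -> V},
    (forall x, u x = \sum_(k < n) v k x) /\
    (forall (k : 'I_n) x, poly_endo (v k) (tnth p k) x = 0).

(* Main.v *)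
(* Write p1 and p2, up to scalars, as (t - a)(t - b) and (t - c)(t - d), and put
   alpha = a + d, beta = b + c, N = (t - alpha)(t - beta).  The polynomials N^k
   and (t - alpha) N^k form a basis of F[t]; let P be the projection onto the
   span of the N^k along that of the (t - alpha) N^k, extended coefficientwise
   to a free module, and let Q = id - P.  Then P (t - alpha) P = 0 and
   Q (t - beta) Q = 0, and these two identities imply that
     v = b + (u - b - d) P   and   w = u - v = d + (u - b - d) Q
   satisfy (v - a)(v - b) = 0 and (w - c)(w - d) = 0. *)

Require Import Defs.
From HB Require Import structures.
From mathcomp Require Import all_boot all_order all_algebra.
From mathcomp Require Import ring.
From mathcomp.multinomials Require Import freeg.

Import GRing.Theory.
Local Open Scope ring_scope.

Section EvenPart.
Variables (F : fieldType) (alpha beta : F).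
Implicit Types (p q : {poly F}) (c : F).

(* The value of P at t^n, computed from P (t x) = alpha P x + (t - beta) Q x. *)
Fixpoint even_part_Xn (n : nat) : {poly F} :=
  if n is n'.+1 then
    alpha%:P * even_part_Xn n' + ('X - beta%:P) * ('X^n' - even_part_Xn n')
  else 1.

(** For [alpha = beta = 0] this is the usual even part of a polynomial, whence the name. *)
Definition even_part (p : {poly F}) : {poly F} :=
  \sum_(i < size p) p`_i *: even_part_Xn i.

Lemma even_part_widen n p : (size p <= n)%N ->
  even_part p = \sum_(i < n) p`_i *: even_part_Xn i.
Proof.
move=> le_pn; rewrite /even_part.
rewrite (big_ord_widen n (fun i => p`_i *: even_part_Xn i) le_pn) big_mkcond /=.
apply: eq_bigr => i _; case: ltnP => // le_pi.
by rewrite nth_default // scale0r.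
Qed.

Lemma even_part_is_linear : linear even_part.
Proof.
move=> c p q; pose n := maxn (size p) (size q).
have le_n : (size (c *: p + q)%R <= n)%N.
  rewrite (leq_trans (size_polyD _ _)) // geq_max leq_maxr andbT.
  by rewrite (leq_trans (size_scale_leq _ _)) ?leq_maxl.
rewrite (even_part_widen n (c *: p + q)) //.
rewrite (even_part_widen n p) ?leq_maxl // (even_part_widen n q) ?leq_maxr //.
rewrite scaler_sumr -big_split; apply: eq_bigr => i _.
by rewrite coefD coefZ scalerDl scalerA.
Qed.

HB.instance Definition _ :=
  GRing.isLinear.Build F {poly F} {poly F} _ even_part even_part_is_linear.

Lemma even_partC c : even_part c%:P = c%:P.
Proof.
rewrite (even_part_widen 1) ?size_polyC ?leq_b1 //.
by rewrite big_ord1 coefC /= alg_polyC.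
Qed.

(** Two identities in one: on the range of P it gives P(t x) = alpha x, and on the kernel P(t x) =
    (t - beta) x, that is Q(t x) = beta x. *)
Lemma even_partMX p :
  even_part ('X * p) =
  alpha%:P * even_part p + ('X - beta%:P) * (p - even_part p).
Proof.
have le_s : (size ('X * p)%R <= (size p).+1)%N.
  by rewrite mulrC (leq_trans (size_polyMleq p _)) ?size_polyX ?addn2.
rewrite (even_part_widen _ _ le_s) big_ord_recl coefXM scale0r add0r.
(* Expanding [p] in monomials turns both sides into sums over one range, which agree termwise by the
   recurrence. *)
rewrite -[X in _ * (X - _)]coefK poly_def /even_part -sumrB !mulr_sumr.
rewrite -big_split; apply: eq_bigr => i _ /=.
by rewrite coefXM /= -scalerBr -!scalerAr scalerDr.
Qed.

(** Put e = P p and o = p - e. By induction P e = e and P o = 0, so the recurrence shows that P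
    fixes alpha e + (t - beta) o, which is P(t p). *)
Lemma even_part_idem p : even_part (even_part p) = even_part p.
Proof.
elim/poly_ind: p => [|p c IHp]; first by rewrite !linear0.
rewrite mulrC linearD linearD /= !even_partC; congr (_ + _).
have odd0 : even_part (p - even_part p) = 0 by rewrite linearB /= IHp subrr.
rewrite even_partMX mulrBl !mul_polyC linearD linearB !linearZ /=.
by rewrite !even_partMX odd0 IHp -!mul_polyC; ring.
Qed.

End EvenPart.

Section CoefficientwiseEvenPart.
Variables (F : fieldType) (alpha beta : F) (I : choiceType).
Implicit Types (D E : {freeg I / {poly F}}).

Definition even_fg D : {freeg I / {poly F}} :=
  fgmap predT (even_part F alpha beta) D.

Lemma coeff_even_fg D i :
  coeff i (even_fg D) = even_part F alpha beta (coeff i D).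
Proof. by rewrite fgmap_f0_coeffE ?linear0 // mulr1n. Qed.

(** Scalars enter as constants [c%:P] because the free module is over F[t], while P is only
    F-linear. *)
Lemma even_fg_linear (c : F) D E :
  even_fg (c%:P *: D + E) = c%:P *: even_fg D + even_fg E.
Proof.
apply/eqP/freeg_eqP => i; rewrite coeffD coeffZ !coeff_even_fg coeffD coeffZ.
by rewrite !mul_polyC linearP.
Qed.

Lemma even_fg_scaleX D :
  even_fg ('X *: D) =
  alpha%:P *: even_fg D + ('X - beta%:P) *: (D - even_fg D).
Proof.
apply/eqP/freeg_eqP => i.
by rewrite coeffD !coeffZ coeffB !coeff_even_fg coeffZ even_partMX.
Qed.

Lemma even_fg_idem D : even_fg (even_fg D) = even_fg D.
Proof.
by apply/eqP/freeg_eqP => i; rewrite !coeff_even_fg even_part_idem.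
Qed.

End CoefficientwiseEvenPart.

(** The coefficientwise P is conjugated by an isomorphism of V^u with a free module, under which u
    becomes multiplication by t. *)
Lemma elementary_projection (F : fieldType) (V : lmodType F)
    (u : {linear V -> V}) (alpha beta : F) :
  elementary u -> exists P : {linear V -> V},
    (forall x, P (P x) = P x) /\
    (forall x, P (u x) =
       alpha *: P x + (u (x - P x) - beta *: (x - P x))).
Proof.
move=> [I [f [g fK gK]]].
(* Constants act on V^u as scalars on V, so F[t]-linear maps are F-linear. *)
have scaleC (c : F) (x : endo_module u) : c%:P *: x = c *: (x : V).
  by rewrite endo_module_scaleE poly_endoC.
have g_lin : linear g := can2_linear fK gK.
pose P (x : V) : V := f (even_fg F alpha beta I (g x)).
have P_lin : linear P.
  move=> c x y; rewrite /P.
  have -> : g (c *: x + y) = c%:P *: g x + g y by rewrite -g_lin scaleC.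
  by rewrite even_fg_linear linearP -scaleC.
pose PL : {linear V -> V} := HB.pack P (GRing.isLinear.Build F V V _ P P_lin).
exists PL; split=> x /=; rewrite /P.
  by rewrite fK even_fg_idem.
have -> : g (u x) = 'X *: g x.
  by rewrite -(can2_scalable fK gK) endo_module_scaleX.
rewrite even_fg_scaleX (linearD f) !(linearZ_LR f) (linearB f) gK.
by rewrite [_ *: (_ - _)]scalerBl endo_module_scaleX !scaleC.
Qed.

(** As [p] is nonzero, no factor vanishes: constant factors go into [c], and each factor of degree
    one contributes its root. *)
Lemma split_polyP (F : fieldType) (p : {poly F}) :
  split_poly p -> p != 0 ->
  exists c (r : seq F), p = c *: \prod_(a <- r) ('X - a%:P).
Proof.
move=> [s le_s ->]; elim: s le_s => [_ _|q s IHs /= /andP[le_q le_s]].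
  by exists 1, [::]; rewrite !big_nil scale1r.
rewrite big_cons mulf_eq0 negb_or => /andP[q0 /(IHs le_s)[c [r ->]]].
have [le1|gt1] := leqP (size q) 1.
  exists (q`_0 * c), r; rewrite {1}(size1_polyC le1).
  by rewrite mul_polyC scalerA.
have size_q : size q = 2 by apply/eqP; rewrite eqn_leq le_q.
have [a /factor_theorem[q' def_q]] := poly2_root size_q.
have q'0 : q' != 0 by apply: contraNneq q0 => q'0; rewrite def_q q'0 mul0r.
have /size1_polyC def_q' : (size q' <= 1)%N.
  move: size_q; rewrite def_q size_Mmonic ?monicXsubC // size_XsubC addn2.
  by case=> ->.
exists (q'`_0 * c), (a :: r).
by rewrite big_cons def_q {1}def_q' mul_polyC -scalerAl -scalerAr scalerA.
Qed.

Lemma split_quadraticP (F : fieldType) (p : {poly F}) :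
  size p = 3 -> split_poly p ->
  exists c a b, p = c *: (('X - a%:P) * ('X - b%:P)).
Proof.
move=> size_p p_split.
have p0 : p != 0 by rewrite -size_poly_eq0 size_p.
have [c [r def_p]] := split_polyP F p p_split p0.
have c0 : c != 0 by apply: contraNneq p0 => c0; rewrite def_p c0 scale0r.
move: size_p; rewrite def_p size_scale // size_prod_XsubC.
case: r def_p => [|a [|b []]] // _ _.
by exists c, a, b; rewrite big_cons big_seq1.
Qed.

Lemma poly_endo_quadratic (F : fieldType) (V : lmodType F)
    (v : {linear V -> V}) (c a b : F) (x : V) :
  poly_endo v (c *: (('X - a%:P) * ('X - b%:P))) x =
  c *: (v (v x - b *: x) - a *: (v x - b *: x)).
Proof.
have XsubCE e y : poly_endo v ('X - e%:P) y = v y - e *: y.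
  rewrite poly_endoDl -polyCN poly_endoC scaleNr.
  by rewrite -['X]mul1r poly_endoMX poly_endo1.
by rewrite poly_endoZ poly_endoM !XsubCE.
Qed.

(** With T = u - (b + d) and Q = id - P, one gets P T P = (a - b) P, hence (v - a) T P = (b - a) T P
    + T P T P = 0. Symmetrically, Q T Q = (c - d) Q gives (w - c) T Q = 0. *)
Lemma quadratic_sum_of_projection (F : fieldType) (V : lmodType F)
    (u P : {linear V -> V}) (a b c d : F)
    (P_idem : forall x, P (P x) = P x)
    (P_comm : forall x, P (u x) =
       (a + d) *: P x + (u (x - P x) - (b + c) *: (x - P x))) :
  exists v w : {linear V -> V}, [/\ forall x, u x = v x + w x,
    forall x, v (v x - b *: x) = a *: (v x - b *: x) &
    forall x, w (w x - d *: x) = c *: (w x - d *: x)].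
Proof.
(* The shift by b + d makes b + T P and d + T Q add up to u. *)
pose T : {linear V -> V} := u \- ((b + d) \*: idfun).
pose v : {linear V -> V} := (b \*: idfun) \+ (T \o P).
pose w : {linear V -> V} := u \- v.
have vE x : v x = b *: x + T (P x) by [].
have TE x : T x = u x - (b + d) *: x by [].
have wE x : w x = d *: x + T (x - P x).
  have -> : w x = u x - v x by [].
  rewrite (linearB T) TE vE opprD !addrA; congr (_ - _).
  by rewrite scalerDl opprD addrA [d *: x + _]addrC addrAC addrK.
exists v, w; split=> x.
- by rewrite addrC subrK.
- have -> : v x - b *: x = T (P x) by rewrite vE addrC addKr.
  have PT : P (T (P x)) = (a - b) *: P x.
    rewrite TE (linearB P) (linearZ_LR P) P_comm !P_idem.
    rewrite subrr (linear0 u) scaler0 subr0 addr0.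
    by rewrite -scalerBl; congr (_ *: _); ring.
  by rewrite vE PT (linearZ_LR T) -scalerDl; congr (_ *: _); ring.
have -> : w x - d *: x = T (x - P x) by rewrite wE addrC addKr.
set y := x - P x.
have Py : P y = 0 by rewrite linearB /= P_idem subrr.
(* Since P y = 0, [P_comm] gives P(u y) = u y - (b + c) y, and (b + c) - (b + d) = c - d. *)
have QT : T y - P (T y) = (c - d) *: y.
  rewrite TE (linearB P) (linearZ_LR P) P_comm Py !scaler0 add0r !subr0.
  rewrite opprB addrC addrA subrK -scalerBl; congr (_ *: _); ring.
by rewrite wE QT (linearZ_LR T) -scalerDl; congr (_ *: _); ring.
Qed.

Theorem theorem1 (F : fieldType) (p1 p2 : {poly F})
    (deg_p1 : size p1 = 3%N) (deg_p2 : size p2 = 3%N)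
    (split_p1 : split_poly p1) (split_p2 : split_poly p2)
    (V : lmodType F) (u : {linear V -> V}) (elem_u : elementary u) :
  poly_sum [tuple p1; p2] u.
Proof.
have [k1 [a [b ->]]] := split_quadraticP F p1 deg_p1 split_p1.
have [k2 [c [d ->]]] := split_quadraticP F p2 deg_p2 split_p2.
have [P [P_idem P_comm]] := elementary_projection F V u (a + d) (b + c) elem_u.
have [v [w [uE v0 w0]]] :=
  quadratic_sum_of_projection F V u P a b c d P_idem P_comm.
exists (fun k : 'I_2 => if k == ord0 then v else w); split=> [x|k x].
  by rewrite big_ord_recl big_ord1 /= -uE.
case: k => [[|[|//]] lt_k] /=; rewrite poly_endo_quadratic /=.
  by rewrite v0 subrr scaler0.
by rewrite w0 subrr scaler0.
Qed.
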